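(* Let $S_4=\{(-1,1,3,-3),(-3,8,1,-7)\}$. If $(t_1,t_2,t_3,t_4)\in S_4$, then for all integers $n\geq 0$, $$a_{1^{t_1}2^{t_2}3^{t_3}4^{t_4}}(2n)>0,\qquad a_{1^{t_1}2^{t_2}3^{t_3}4^{t_4}}(4n+1)>0,\qquad a_{1^{t_1}2^{t_2}3^{t_3}4^{t_4}}(4n+3)<0.$$
   Context: For $|q|<1$ (or as formal power series in $q$) let $f_j:=(q^j;q^j)_\infty=\prod_{k\ge 1}(1-q^{jk})$ for each positive integer $j$. For a positive integer $m$ and integers $t_1,\dots,t_m$ (possibly zero or negative), the integers $a_{1^{t_1}2^{t_2}\cdots m^{t_m}}(n)$, $n\ge 0$, are defined by $\sum_{n=0}^\infty a_{1^{t_1}2^{t_2}\cdots m^{t_m}}(n)q^n=f_1^{t_1}f_2^{t_2}\cdots f_m^{t_m}$. *)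

(* Defs.v *)
From HB Require Import structures.
From mathcomp Require Import all_boot all_order all_algebra.
From mathcomp Require Import boolp.

Set Implicit Arguments.
Unset Strict Implicit.
Unset Printing Implicit Defensive.

Import Order.TTheory GRing.Theory Num.Theory.
Local Open Scope ring_scope.

(* Formal power series: [f n] is the coefficient of q^n.  This is a record    *)
(* and not [nat -> R] itself, so that the product is the Cauchy product and   *)
(* not the pointwise one.                                                     *)
Record fps (R : Type) := FPS { fps_coef :> nat -> R }.

Lemma fpsP (R : Type) (f g : fps R) : f =1 g -> f = g.
Proof. by case: f g => [f] [g] /= fg; congr FPS; apply/funext. Qed.

HB.instance Definition _ (R : Type) := gen_eqMixin (fps R).
HB.instance Definition _ (R : Type) := gen_choiceMixin (fps R).

Section FpsRing.
Variable R : comUnitRingType.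
Implicit Types f g h : fps R.

Definition fps_zero : fps R := FPS (fun=> 0).
Definition fps_opp f : fps R := FPS (fun n => - f n).
Definition fps_add f g : fps R := FPS (fun n => f n + g n).
Definition fps_one : fps R := FPS (fun n => (n == 0%N)%:R).
Definition fps_mul f g : fps R :=
  FPS (fun n => \sum_(i < n.+1) f i * g (n - i)%N).

Lemma fps_addA : associative fps_add.
Proof. by move=> f g h; apply: fpsP => n /=; rewrite addrA. Qed.

Lemma fps_addC : commutative fps_add.
Proof. by move=> f g; apply: fpsP => n /=; rewrite addrC. Qed.

Lemma fps_add0 : left_id fps_zero fps_add.
Proof. by move=> f; apply: fpsP => n /=; rewrite add0r. Qed.

Lemma fps_addN : left_inverse fps_zero fps_opp fps_add.
Proof. by move=> f; apply: fpsP => n /=; rewrite addNr. Qed.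

HB.instance Definition _ :=
  GRing.isZmodule.Build (fps R) fps_addA fps_addC fps_add0 fps_addN.

Definition fps_trunc n f : {poly R} := \poly_(i < n.+1) f i.

Lemma fps_mulE n m f g : (m <= n)%N ->
  fps_mul f g m = (fps_trunc n f * fps_trunc n g)`_m.
Proof.
move=> le_mn; rewrite coefM; apply: eq_bigr => i _; rewrite !coef_poly.
have le_im : (i <= m)%N by rewrite -ltnS.
by rewrite !ltnS (leq_trans le_im) // (leq_trans (leq_subr _ _)).
Qed.

Lemma fps_mulA : associative fps_mul.
Proof.
move=> f g h; apply: fpsP => n.
transitivity ((fps_trunc n f * (fps_trunc n g * fps_trunc n h))`_n).
  rewrite coefM; apply: eq_bigr => i _.
  by rewrite -(fps_mulE _ _ (leq_subr _ _)) coef_poly ltn_ord.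
rewrite mulrA coefM; apply: eq_bigr => i _.
by rewrite -fps_mulE -1?ltnS// coef_poly ltnS leq_subr.
Qed.

Lemma fps_mulC : commutative fps_mul.
Proof. by move=> f g; apply: fpsP => n; rewrite !(@fps_mulE n) // mulrC. Qed.

Lemma fps_mul1 : left_id fps_one fps_mul.
Proof.
move=> f; apply: fpsP => n /=; rewrite big_ord_recl /= mul1r subn0.
by rewrite big1 ?addr0 // => i _; rewrite mul0r.
Qed.

Lemma fps_mulDl : left_distributive fps_mul fps_add.
Proof.
move=> f g h; apply: fpsP => n /=; rewrite -big_split /=.
by apply: eq_bigr => i _; rewrite mulrDl.
Qed.

Lemma fps_one_neq0 : fps_one != fps_zero.
Proof.
by apply/eqP => /(congr1 (fun f : fps R => f 0%N)) /= /eqP; rewrite oner_eq0.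
Qed.

HB.instance Definition _ := GRing.Zmodule_isComNzRing.Build (fps R)
  fps_mulA fps_mulC fps_mul1 fps_mulDl fps_one_neq0.

Definition fps_unit : pred (fps R) := fun f => f 0%N \is a GRing.unit.

(* The first n coefficients of 1/f, obtained by solving g * f = 1 for the     *)
(* coefficients of g one at a time.                                           *)
Fixpoint fps_inv_seq f n : seq R :=
  if n is n'.+1 then
    let s := fps_inv_seq f n' in
    rcons s ((f 0%N)^-1 * ((n' == 0%N)%:R - \sum_(i < n') s`_i * f (n' - i)%N))
  else [::].

Definition fps_inv f : fps R :=
  if fps_unit f then FPS (fun n => (fps_inv_seq f n.+1)`_n) else f.

Lemma size_fps_inv_seq f n : size (fps_inv_seq f n) = n.
Proof. by elim: n => //= n IHn; rewrite size_rcons IHn. Qed.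

Lemma nth_fps_inv_seq f n i : (i < n)%N ->
  (fps_inv_seq f n)`_i = (fps_inv_seq f i.+1)`_i.
Proof.
elim: n => // n IHn; rewrite ltnS leq_eqVlt => /predU1P[-> //|lt_in].
by rewrite -IHn //= nth_rcons size_fps_inv_seq lt_in.
Qed.

Lemma fps_mulV : {in fps_unit, left_inverse 1 fps_inv *%R}.
Proof.
move=> f Uf; have Uf0 : f 0%N \is a GRing.unit := Uf.
apply: fpsP => n; rewrite /fps_inv (_ : fps_unit f = true) //=.
rewrite big_ord_recr /= nth_rcons size_fps_inv_seq ltnn eqxx subnn.
rewrite mulrAC mulVr // mul1r addrC.
rewrite -[RHS](subrK (\sum_(i < n) (fps_inv_seq f n)`_i * f (n - i)%N)).
by congr (_ + _); apply: eq_bigr => i _; rewrite [in RHS]nth_fps_inv_seq.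
Qed.

Lemma fps_unitPl f g : g * f = 1 -> fps_unit f.
Proof.
move=> /(congr1 (fun h : fps R => h 0%N)) /=; rewrite big_ord1 subn0 => gf1.
by apply/unitrP; exists (g 0%N); split; rewrite // mulrC.
Qed.

Lemma fps_inv_out : {in [predC fps_unit], fps_inv =1 id}.
Proof. by move=> f /negPf Uf; rewrite /fps_inv (_ : fps_unit f = false). Qed.

HB.instance Definition _ := GRing.ComNzRing_hasMulInverse.Build (fps R)
  fps_mulV fps_unitPl fps_inv_out.

End FpsRing.

(* f_j = (q^j; q^j)_oo for j > 0.  The factors with k > n do not contribute   *)
(* to the coefficient of q^n (see [eulerE]), so this is the coefficientwise   *)
(* limit of the partial products.                                             *)
Definition euler (j : nat) : fps int :=
  FPS (fun n => (\prod_(1 <= k < n.+1) (1 - 'X^(j * k)) : {poly int})`_n).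

Lemma eulerE j n N : (0 < j)%N -> (n <= N)%N ->
  euler j n = (\prod_(1 <= k < N.+1) (1 - 'X^(j * k)) : {poly int})`_n.
Proof.
move=> j_gt0; elim: N => [|N IHN]; first by rewrite leqn0 => /eqP->.
rewrite leq_eqVlt => /predU1P[-> //|le_nN].
rewrite IHN // [in RHS]big_nat_recr //= mulrBr mulr1 coefB coefMXn.
by rewrite (leq_trans le_nN) ?subr0 // leq_pmull.
Qed.

Lemma euler_unit j : euler j \is a GRing.unit.
Proof. by rewrite unfold_in /= /fps_unit /= big_geq // coef1. Qed.

(* a_{1^{t_1} 2^{t_2} ... m^{t_m}}(n); the entries of t are indexed from 0.   *)
Definition eta_coef (m : nat) (t : m.-tuple int) (n : nat) : int :=
  (\prod_(i < m) euler i.+1 ^ tnth t i) n.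

Definition S4 : seq (4.-tuple int) :=
  [:: [tuple -1; 1; 3; -3]; [tuple -3; 8; 1; -7]].

(* Main.v *)
(* Write f_j for [euler j] and v = q f_2^2 f_12^4 / (f_4^4 f_6^2).  Everything *)
(* rests on                                                                   *)
(*   1 + v   = f_2^2 f_3^3 f_12 / (f_1 f_4^3 f_6^2),                          *)
(*   1 + 3 v = f_2^9 f_3 f_12^2 / (f_1^3 f_4^6 f_6^3),                        *)
(* since the two series of the theorem are eta quotients in q^2 multiplied by *)
(* 1 + v and 1 + 3 v, which gives their 2-dissections.  Up to q -> -q, both   *)
(* parts of each dissection (after a further use of 1 + v in one case) are    *)
(* products of series with visibly positive or nonnegative coefficients.      *)
(*   The first identity is the three-term relation for the theta functions    *)
(* j_k = (q^k, q^(12-k), q^12; q^12)_oo,                                      *)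
(*   j_2 j_6 j_3^2 = j_1 j_5 (j_4^2 + q j_2^2),                               *)
(* which follows from the Jacobi triple product by writing products of two    *)
(* thetas as 2x2 minors.  The second is an algebraic consequence: q -> -q     *)
(* turns 1 + v into 1 - v; the product 1 - v^2 is 1 - u at q^2, with          *)
(* u = q f_1^4 f_6^8 / (f_2^8 f_3^4); and the right-hand side T of the second *)
(* identity satisfies u T = v (1 - v) and (1 - u) T = (1 + v)^2.              *)

From HB Require Import structures.
Require Import Defs.
From mathcomp Require Import all_boot all_order all_algebra.
From mathcomp Require Import boolp classical_sets fsbigop.
From mathcomp Require Import ring zify.

Set Implicit Arguments.
Unset Strict Implicit.
Unset Printing Implicit Defensive.

Import Order.TTheory GRing.Theory Num.Theory.
Local Open Scope ring_scope.

(** * Formal power series and infinite products *)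

(** Each series of the theorem is an eta quotient in q^2 times 1 + v or 1 + 3v, and v is q times a
    series in q^2. Hence each series has the form F(q^2) + q G(q^2), with F = f_3^2 / (f_1 f_6) and
    G = f_1 f_6^3 / f_2^4 in the first case, F = f_3^3 / (f_1 f_2 f_6^2) and G = 3 f_1 f_3 f_6^2 /
    f_2^5 in the second ([etaq_dissection1], [etaq_dissection2]). If F and G(-q) have positive
    coefficients, the signs follow ([dissect2_sign_pattern]).

    The identities come from [jacobi_triple_product] through [alt_theta12_plucker], [one_plus_v] and
    [one_plus_3v]. Positivity rests on three infinite products, those of [f2_over_f1_pos],
    [f3_sqr_over_f1_f6_pos] and [distinct_odd_nneg], together with 1 / f_1, and on the substitutions
    q -> q^2 and q -> q^3. Only F of the second case is not directly such a product: a second use of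
    1 + v splits it into two that are ([even_part2_pos]). *)

Section FormalPowerSeries.
Variable R : comUnitRingType.
Implicit Types (f g h : fps R) (u v : nat -> fps R).

Lemma fps_coefD f g n : (f + g) n = f n + g n. Proof. by []. Qed.
Lemma fps_coefN f n : (- f) n = - f n. Proof. by []. Qed.
Lemma fps_coefB f g n : (f - g) n = f n - g n. Proof. by []. Qed.
Lemma fps_coef1 n : (1 : fps R) n = (n == 0%N)%:R. Proof. by []. Qed.
Lemma fps_coefM f g n : (f * g) n = \sum_(i < n.+1) f i * g (n - i)%N.
Proof. by []. Qed.

Lemma fps_coef_signM s f n : ((-1) ^+ s * f) n = (-1) ^+ s * f n.
Proof.
elim: s => [|s IHs]; first by rewrite !mul1r.
by rewrite !exprS !mulN1r !mulNr fps_coefN IHs.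
Qed.

Lemma fps_coef_sum (I : Type) (r : seq I) (P : pred I) (F : I -> fps R) n :
  (\sum_(i <- r | P i) F i) n = \sum_(i <- r | P i) F i n.
Proof. by elim/big_rec2: _ => // i _ y _ <-. Qed.

Definition fpsX m : fps R := FPS (fun n => (n == m)%:R).

Lemma fps_coefX m n : fpsX m n = (n == m)%:R. Proof. by []. Qed.

Lemma fps_coefXM m f n : (fpsX m * f) n = if (m <= n)%N then f (n - m)%N else 0.
Proof.
rewrite fps_coefM; case: ifPn => [le_mn|].
  have lt_mn : (m < n.+1)%N by [].
  rewrite (bigD1 (Ordinal lt_mn)) //= eqxx mul1r big1 ?addr0 // => i.
  by rewrite -val_eqE /= => /negPf ->; rewrite mul0r.
rewrite -ltnNge => lt_nm; apply: big1 => i _; rewrite fps_coefX.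
by rewrite ltn_eqF ?mul0r // (leq_trans (ltn_ord i)).
Qed.

Lemma fpsX0 : fpsX 0 = 1. Proof. exact: fpsP. Qed.

Lemma fpsXD m n : fpsX (m + n)%N = fpsX m * fpsX n.
Proof.
apply: fpsP => k; rewrite fps_coefXM !fps_coefX; case: leqP => [le_mk|lt_km].
  by rewrite -{1}(subnKC le_mk) eqn_add2l.
by rewrite ltn_eqF // (leq_trans lt_km) ?leq_addr.
Qed.

Definition fps_eqmod N f g := forall n, (n < N)%N -> f n = g n.

Lemma fps_eqmodP f g : (forall N, fps_eqmod N f g) -> f = g.
Proof. by move=> fg; apply: fpsP => n; apply: (fg n.+1). Qed.

Lemma fps_eqmod_sym N f g : fps_eqmod N f g -> fps_eqmod N g f.
Proof. by move=> fg n /fg. Qed.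

Lemma fps_eqmod_trans N g f h :
  fps_eqmod N f g -> fps_eqmod N g h -> fps_eqmod N f h.
Proof. by move=> fg gh n ltnN; rewrite fg // gh. Qed.

Lemma fps_eqmodW N M f g : (M <= N)%N -> fps_eqmod N f g -> fps_eqmod M f g.
Proof. by move=> leMN fg n /leq_trans/(_ leMN); apply: fg. Qed.

Lemma fps_eqmodM N f g f' g' :
  fps_eqmod N f g -> fps_eqmod N f' g' -> fps_eqmod N (f * f') (g * g').
Proof.
move=> fg fg' n ltnN; rewrite !fps_coefM; apply: eq_bigr => i _.
by rewrite fg ?fg' // (leq_ltn_trans _ ltnN) ?leq_subr // -ltnS.
Qed.

Lemma fps_eqmodXM N m f g :
  fps_eqmod N f g -> fps_eqmod (m + N)%N (fpsX m * f) (fpsX m * g).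
Proof.
move=> fg n lt_n; rewrite !fps_coefXM; case: (leqP m n) => // le_mn.
by rewrite fg // -(ltn_add2l m) subnKC.
Qed.

Lemma fps_eqmod_sum N (I : Type) (r : seq I) (F G : I -> fps R) :
  (forall i, fps_eqmod N (F i) (G i)) ->
  fps_eqmod N (\sum_(i <- r) F i) (\sum_(i <- r) G i).
Proof.
by move=> FG n ltnN; rewrite !fps_coef_sum; apply: eq_bigr => i _; apply: FG.
Qed.

Lemma fps_eqmod_prod N (I : eqType) (r : seq I) (P : pred I) (F G : I -> fps R) :
  (forall i, i \in r -> P i -> fps_eqmod N (F i) (G i)) ->
  fps_eqmod N (\prod_(i <- r | P i) F i) (\prod_(i <- r | P i) G i).
Proof.
move=> FG; rewrite big_seq_cond [X in fps_eqmod _ _ X]big_seq_cond.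
elim/big_rec2: _ => // i f g /andP[ri Pi] fg.
exact: fps_eqmodM (FG i ri Pi) fg.
Qed.

(** * Infinite products of power series *)

Definition fps_multipliable u := forall k, fps_eqmod k.+1 (u k) 1.

(** For a multipliable [u] the factor [u k] is 1 + O(q^(k+1)), so the factors with k >= n do not
    affect the coefficient of q^n. *)
Definition fps_iprod u : fps R := FPS (fun n => (\prod_(0 <= k < n) u k) n).

Lemma fps_prod_eqmod u N K K' : fps_multipliable u ->
  (N <= K)%N -> (N <= K')%N ->
  fps_eqmod N.+1 (\prod_(0 <= k < K) u k) (\prod_(0 <= k < K') u k).
Proof.
move=> mu; have to_N M : (N <= M)%N ->
    fps_eqmod N.+1 (\prod_(0 <= k < M) u k) (\prod_(0 <= k < N) u k).
  elim: M => [|M IHM]; first by rewrite leqn0 => /eqP->.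
  rewrite leq_eqVlt => /predU1P[-> //|le_NM]; rewrite big_nat_recr //=.
  rewrite -[X in fps_eqmod _ _ X]mulr1; apply: fps_eqmodM; first exact: IHM.
  by apply: fps_eqmodW (mu M); rewrite ltnS.
move=> NK NK'; apply: fps_eqmod_trans (to_N _ NK) _.
exact/fps_eqmod_sym/to_N.
Qed.

Lemma fps_iprod_eqmod u N K : fps_multipliable u -> (N <= K)%N ->
  fps_eqmod N.+1 (fps_iprod u) (\prod_(0 <= k < K) u k).
Proof.
move=> mu leNK n ltnN /=; apply: (fps_prod_eqmod (N := n)) => //.
exact: leq_trans leNK.
Qed.

Lemma fps_iprod_uniq u f : fps_multipliable u ->
  (forall N, exists2 K, (N <= K)%N &
     fps_eqmod N.+1 f (\prod_(0 <= k < K) u k)) ->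
  fps_iprod u = f.
Proof.
move=> mu fu; apply: fps_eqmodP => N; have [K leNK fK] := fu N.
apply: fps_eqmodW (leqnSn N) _; apply: fps_eqmod_trans (fps_iprod_eqmod mu leNK) _.
exact: fps_eqmod_sym.
Qed.

Lemma eq_fps_iprod u v : u =1 v -> fps_iprod u = fps_iprod v.
Proof. by move=> uv; apply: fpsP => n /=; rewrite (eq_bigr _ (fun k _ => uv k)). Qed.

Lemma fps_multipliableM u v : fps_multipliable u -> fps_multipliable v ->
  fps_multipliable (fun k => u k * v k).
Proof. by move=> mu mv k; rewrite -[1]mulr1; apply: fps_eqmodM. Qed.

Lemma fps_multipliable_prod (I : eqType) (r : seq I) (P : pred I)
    (F : I -> nat -> fps R) :
  (forall i, P i -> fps_multipliable (F i)) ->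
  fps_multipliable (fun k => \prod_(i <- r | P i) F i k).
Proof.
move=> mF k; have {2}<- : \prod_(i <- r | P i) (1 : fps R) = 1 by rewrite big1_eq.
by apply: fps_eqmod_prod => i _ Pi; apply: mF.
Qed.

Lemma fps_iprod1 : fps_iprod (fun=> 1) = 1.
Proof.
by apply: fps_iprod_uniq => // N; exists N => //; rewrite big1_eq.
Qed.

Lemma fps_iprodM u v : fps_multipliable u -> fps_multipliable v ->
  fps_iprod (fun k => u k * v k) = fps_iprod u * fps_iprod v.
Proof.
move=> mu mv; apply: fps_iprod_uniq; first exact: fps_multipliableM.
by move=> N; exists N => //; rewrite big_split; apply: fps_eqmodM;
  apply: fps_iprod_eqmod.
Qed.

Lemma fps_iprod_prod (I : eqType) (r : seq I) (P : pred I)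
    (F : I -> nat -> fps R) :
  (forall i, P i -> fps_multipliable (F i)) ->
  fps_iprod (fun k => \prod_(i <- r | P i) F i k) =
  \prod_(i <- r | P i) fps_iprod (F i).
Proof.
move=> mF; apply: fps_iprod_uniq; first exact: fps_multipliable_prod.
move=> N; exists N => //; rewrite exchange_big; apply: fps_eqmod_prod => i _ Pi.
exact/fps_iprod_eqmod/leqnn/mF.
Qed.

Lemma fps_multipliable_sub u (s : nat -> nat) : fps_multipliable u ->
  (forall k, k <= s k)%N -> fps_multipliable (fun k => u (s k)).
Proof. by move=> mu les k; apply: fps_eqmodW (mu (s k)); rewrite ltnS. Qed.

(** The factors are sorted by the residue of their index mod m; at finite level this cuts m N
    factors into N blocks of length m. *)
Lemma fps_iprod_regroup u m : (0 < m)%N -> fps_multipliable u ->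
  fps_iprod u = \prod_(r < m) fps_iprod (fun i => u (m * i + r)%N).
Proof.
move=> m0 mu; have mur (r : 'I_m) : fps_multipliable (fun i => u (m * i + r)%N).
  apply: (fps_multipliable_sub (s := fun i => (m * i + r)%N)) => // k.
  by apply: leq_trans (leq_addr _ _); rewrite leq_pmull.
rewrite -fps_iprod_prod => [|r _]; last exact: mur.
apply: fps_eqmodP => N; apply: fps_eqmodW (leqnSn N) _.
have muP : fps_multipliable (fun k => \prod_(r < m) u (m * k + r)%N).
  by apply: fps_multipliable_prod => r _; apply: mur.
apply: fps_eqmod_trans (fps_eqmod_sym (fps_iprod_eqmod muP (leqnn N))).
apply: fps_eqmod_trans (fps_iprod_eqmod (K := m * N) mu _) _.
  by rewrite leq_pmull.
suff -> : \prod_(0 <= k < m * N) u k =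
    \prod_(0 <= k < N) \prod_(r < m) u (m * k + r)%N by [].
elim: N => [|N IHN]; first by rewrite muln0 !big_geq.
rewrite big_nat_recr //= -IHN mulnS addnC (big_cat_nat (n := (m * N)%N)) ?leq_addr //=.
congr (_ * _); rewrite -{1}[(m * N)%N]add0n big_addn addKn big_mkord.
by apply: eq_bigr => r _; rewrite addnC.
Qed.

Lemma fps_iprod_recl u : fps_multipliable u ->
  fps_iprod u = u 0%N * fps_iprod (fun k => u k.+1).
Proof.
move=> mu; apply: fps_iprod_uniq => // N; exists N.+1 => //.
rewrite big_nat_recl //; apply: fps_eqmodM => //.
by apply: fps_iprod_eqmod => //; apply: fps_multipliable_sub.
Qed.

Lemma fps_iprod_coef0 u : fps_iprod u 0%N = 1.
Proof. by rewrite /= big_geq. Qed.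

(** * The substitutions q -> q^d and q -> -q *)

Definition fps_dil d f : fps R :=
  FPS (fun n => if (d %| n)%N then f (n %/ d)%N else 0).

Definition fps_neg f : fps R := FPS (fun n => (-1) ^+ n * f n).

(** Truncation to polynomials makes multiplicativity of the dilation a consequence of composition
    with X^d being a ring morphism. *)
Lemma fps_dil_comp d f m n : (0 < d)%N -> (n %/ d <= m)%N ->
  fps_dil d f n = (fps_trunc m f \Po 'X^d)`_n.
Proof.
move=> d0 lenm; rewrite coef_comp_poly_Xn //=; case: ifP => // _.
by rewrite coef_poly ltnS lenm.
Qed.

Lemma fps_dilM d f g : (0 < d)%N -> fps_dil d (f * g) = fps_dil d f * fps_dil d g.
Proof.
move=> d0; apply: fpsP => n; rewrite fps_coefM.
transitivity ((fps_trunc n f * fps_trunc n g \Po 'X^d)`_n).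
  rewrite coef_comp_poly_Xn //=; case: ifP => // _.
  by rewrite -fps_mulE // leq_div.
rewrite rmorphM coefM; apply: eq_bigr => i _.
by rewrite !(@fps_dil_comp _ _ n) // (leq_trans (leq_div _ _)) // ?leq_subr // -ltnS.
Qed.

Lemma fps_dilB d f g : fps_dil d (f - g) = fps_dil d f - fps_dil d g.
Proof. by apply: fpsP => n; rewrite fps_coefB /=; case: ifP; rewrite ?subr0. Qed.

Lemma fps_dilX d m : (0 < d)%N -> fps_dil d (fpsX m) = fpsX (d * m)%N.
Proof.
move=> d0; apply: fpsP => n /=; case: dvdnP => [[k ->]|kN].
  by rewrite mulnK // mulnC eqn_pmul2l.
by case: eqP => // n_dm; case: kN; exists m; rewrite mulnC.
Qed.

Lemma fps_dil1 d : (0 < d)%N -> fps_dil d 1 = 1.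
Proof. by move=> d0; rewrite -fpsX0 fps_dilX // muln0. Qed.

Lemma fps_dil_inj d : (0 < d)%N -> injective (fps_dil d).
Proof.
move=> d0 f g fg; apply: fpsP => n.
by have /= := congr1 (fun h : fps R => h (n * d)%N) fg; rewrite dvdn_mull // mulnK.
Qed.

Lemma fps_negM f g : fps_neg (f * g) = fps_neg f * fps_neg g.
Proof.
apply: fpsP => n; rewrite fps_coefM /= mulr_sumr; apply: eq_bigr => i _.
by rewrite mulrACA -exprD subnKC // -ltnS.
Qed.

Lemma fps_neg1 : fps_neg 1 = 1.
Proof. by apply: fpsP => -[|n] //=; rewrite ?mulr1 // mulr0. Qed.

Lemma fps_negD f g : fps_neg (f + g) = fps_neg f + fps_neg g.
Proof. by apply: fpsP => n; rewrite fps_coefD /= -mulrDr. Qed.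

Lemma fps_negB f g : fps_neg (f - g) = fps_neg f - fps_neg g.
Proof. by apply: fpsP => n; rewrite fps_coefB /= -mulrBr. Qed.

Lemma fps_negX m : fps_neg (fpsX m) = (-1) ^+ m * fpsX m.
Proof.
apply: fpsP => n; rewrite fps_coef_signM /=.
by case: eqVneq => [->//|_]; rewrite !mulr0.
Qed.

Lemma fps_neg_dil d f : ~~ odd d -> fps_neg (fps_dil d f) = fps_dil d f.
Proof.
move=> dE; apply: fpsP => n /=; case: dvdnP => [[k ->]|]; last by rewrite mulr0.
by rewrite -signr_odd oddM (negPf dE) andbF mul1r.
Qed.

Lemma fps_neg_dil_odd d f : odd d ->
  fps_neg (fps_dil d f) = fps_dil d (fps_neg f).
Proof.
move=> dO; apply: fpsP => n /=; case: dvdnP => [[k ->]|]; last by rewrite mulr0.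
rewrite -signr_odd oddM dO andbT signr_odd mulnK //.
by case: (d) dO.
Qed.

Lemma fps_neg_iprod u : fps_neg (fps_iprod u) = fps_iprod (fun k => fps_neg (u k)).
Proof.
apply: fpsP => n /=; rewrite -(big_morph _ fps_negM fps_neg1) /=.
by [].
Qed.

Lemma fps_dil_eqmod d N f g : (0 < d)%N ->
  fps_eqmod N f g -> fps_eqmod N (fps_dil d f) (fps_dil d g).
Proof.
move=> d0 fg n ltnN /=; case: ifP => // _; apply: fg.
by apply: leq_ltn_trans ltnN; apply: leq_div.
Qed.

Lemma fps_multipliable_dil d u : (0 < d)%N ->
  fps_multipliable u -> fps_multipliable (fun k => fps_dil d (u k)).
Proof. by move=> d0 mu k; rewrite -(fps_dil1 d0); apply: fps_dil_eqmod. Qed.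

Lemma fps_dil_iprod d u : (0 < d)%N -> fps_multipliable u ->
  fps_dil d (fps_iprod u) = fps_iprod (fun k => fps_dil d (u k)).
Proof.
move=> d0 mu; apply/esym/fps_iprod_uniq; first exact: fps_multipliable_dil.
move=> N; exists N => //.
rewrite -(big_morph _ (fun f g => fps_dilM f g d0) (fps_dil1 d0)).
by apply: fps_dil_eqmod => //; apply: fps_iprod_eqmod.
Qed.

End FormalPowerSeries.

(** * Signed generating functions *)

(** This makes every coefficient of [fps_gen] a genuine finite sum; over an infinite support that
    sum would default to 0. *)
Definition locally_finite (I : eqType) (w : I -> nat) :=
  forall N, exists r : seq I, forall i, (w i < N)%N -> i \in r.

Lemma locally_finite_uniq (I : eqType) (w : I -> nat) N : locally_finite w ->
  exists2 r : seq I, uniq r & forall i, (w i < N)%N -> i \in r.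
Proof.
move=> /(_ N) [r rN]; exists (undup r); first exact: undup_uniq.
by move=> i /rN; rewrite mem_undup.
Qed.

Lemma locally_finite_le (I : eqType) (w w' : I -> nat) :
  (forall i, w i <= w' i)%N -> locally_finite w -> locally_finite w'.
Proof.
move=> ww' lfw N; have [r rN] := lfw N; exists r => i lt_w'.
by rewrite rN // (leq_ltn_trans _ lt_w').
Qed.

Lemma locally_finite_pair (I J : eqType) (w : I -> nat) (w' : J -> nat) :
  locally_finite w -> locally_finite w' ->
  locally_finite (fun p : I * J => w p.1 + w' p.2)%N.
Proof.
move=> lfw lfw' N; have [r rN] := lfw N; have [r' r'N] := lfw' N.
exists [seq (i, j) | i <- r, j <- r'] => -[i j] /= lt_w.
by apply: allpairs_f; [apply: rN|apply: r'N]; apply: leq_ltn_trans lt_w;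
  rewrite ?leq_addr ?leq_addl.
Qed.

Section SignedGeneratingFunctions.
Variable R : comUnitRingType.


(* The sum of [(-1)^(s i) q^(w i)] over all [i : I]. *)
Definition fps_gen (I : choiceType) (s w : I -> nat) : fps R :=
  FPS (fun n => \sum_(i \in [set` [pred i | w i == n]]) ((-1) ^+ s i : R)).

Lemma fps_coef_sign s w n :
  ((-1) ^+ s * fpsX R w) n = if w == n then (-1) ^+ s else 0.
Proof.
by rewrite fps_coef_signM /= eq_sym; case: eqP; rewrite ?mulr1 ?mulr0.
Qed.

Lemma fps_gen_eqmod (I : choiceType) (s w : I -> nat) (r : seq I) N :
  uniq r -> (forall i, (w i < N)%N -> i \in r) ->
  fps_eqmod N (fps_gen s w) (\sum_(i <- r) (-1) ^+ s i * fpsX R (w i)).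
Proof.
move=> r_uniq rN n ltnN; rewrite fps_coef_sum.
under eq_bigr do rewrite fps_coef_sign.
rewrite -big_mkcond; apply/esym/bigfs => // i /= /eqP wi.
by rewrite rN // wi.
Qed.

Lemma fps_gen_uniq (I : choiceType) (s w : I -> nat) (f : fps R) :
  (forall N, exists r : seq I, [/\ uniq r, forall i, (w i < N)%N -> i \in r &
     fps_eqmod N f (\sum_(i <- r) (-1) ^+ s i * fpsX R (w i))]) ->
  f = fps_gen s w.
Proof.
move=> fr; apply: fps_eqmodP => N; have [r [r_uniq rN fN]] := fr N.
exact: fps_eqmod_trans fN (fps_eqmod_sym (fps_gen_eqmod _ r_uniq rN)).
Qed.

Lemma fps_genM (I J : choiceType) (s w : I -> nat) (s' w' : J -> nat) :
  locally_finite w -> locally_finite w' ->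
  fps_gen s w * fps_gen s' w' =
  fps_gen (fun p : I * J => s p.1 + s' p.2)%N (fun p => w p.1 + w' p.2)%N.
Proof.
move=> lfw lfw'; apply: fps_gen_uniq => N.
have [r r_uniq rN] := locally_finite_uniq N lfw.
have [r' r'_uniq r'N] := locally_finite_uniq N lfw'.
exists [seq (i, j) | i <- r, j <- r']; split.
- by apply: allpairs_uniq => // -[? ?] [].
- move=> [i j] /= lt_w; apply: allpairs_f; [apply: rN|apply: r'N];
    by apply: leq_ltn_trans lt_w; rewrite ?leq_addr ?leq_addl.
- rewrite big_allpairs_dep /=.
  have -> : \sum_(i <- r) \sum_(j <- r')
      (-1) ^+ (s i + s' j) * fpsX R (w i + w' j)%N =
      (\sum_(i <- r) (-1) ^+ s i * fpsX R (w i)) *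
      (\sum_(j <- r') (-1) ^+ s' j * fpsX R (w' j)).
    rewrite mulr_suml; apply: eq_bigr => i _; rewrite mulr_sumr.
    by apply: eq_bigr => j _; rewrite exprD fpsXD mulrACA.
  by apply: fps_eqmodM; apply: fps_gen_eqmod.
Qed.

Lemma fps_genD (I J : choiceType) (s w : I -> nat) (s' w' : J -> nat) :
  locally_finite w -> locally_finite w' ->
  fps_gen s w + fps_gen s' w' =
  fps_gen (fun x : I + J => match x with inl i => s i | inr j => s' j end)
          (fun x => match x with inl i => w i | inr j => w' j end).
Proof.
move=> lfw lfw'; apply: fps_gen_uniq => N.
have [r r_uniq rN] := locally_finite_uniq N lfw.
have [r' r'_uniq r'N] := locally_finite_uniq N lfw'.
have inlI : injective (@inl I J) by move=> ? ? [].
have inrI : injective (@inr I J) by move=> ? ? [].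
exists ([seq inl i | i <- r] ++ [seq inr j | j <- r']); split.
- rewrite cat_uniq !map_inj_uniq // r_uniq r'_uniq andbT /=.
  by apply/hasPn => _ /mapP[j _ ->]; apply/mapP => -[].
- by move=> [i /rN|j /r'N]; rewrite mem_cat (mem_map inlI, mem_map inrI) => ->;
    rewrite ?orbT.
- rewrite big_cat !big_map /= => n ltnN; rewrite !fps_coefD.
  by congr (_ + _); apply: fps_gen_eqmod ltnN.
Qed.

Lemma fps_gen_reindex (I J : choiceType) (h : I -> J) (s w : J -> nat) :
  bijective h -> locally_finite w ->
  fps_gen s w = fps_gen (fun i => s (h i)) (fun i => w (h i)).
Proof.
move=> [g hK gK] lfw; apply: fps_gen_uniq => N.
have [r r_uniq rN] := locally_finite_uniq N lfw.
exists (map g r); split.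
- by rewrite map_inj_uniq //; apply: can_inj gK.
- by move=> i lt_w; apply/mapP; exists (h i); rewrite ?hK ?rN.
- by rewrite big_map; under eq_bigr do rewrite gK; apply: fps_gen_eqmod.
Qed.

Lemma fps_gen_shift (I : choiceType) (s w : I -> nat) m : locally_finite w ->
  fpsX R m * fps_gen s w = fps_gen s (fun i => m + w i)%N.
Proof.
move=> lfw; apply: fps_gen_uniq => N.
have [r r_uniq rN] := locally_finite_uniq N lfw.
exists r; split=> // [i lt_w|]; first by rewrite rN // (leq_ltn_trans _ lt_w) ?leq_addl.
under [X in fps_eqmod _ _ X]eq_bigr do rewrite fpsXD mulrCA.
by rewrite -mulr_sumr; apply: fps_eqmodM => //; apply: fps_gen_eqmod.
Qed.

Lemma eq_fps_gen (I : choiceType) (s w s' w' : I -> nat) :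
  (forall i, odd (s i) = odd (s' i)) -> w =1 w' ->
  fps_gen s w = fps_gen s' w'.
Proof.
move=> ss' ww'; rewrite /fps_gen (funext ww'); apply: fpsP => n /=.
by apply: eq_fsbigr => i _; rewrite -signr_odd ss' signr_odd.
Qed.

Lemma fps_genN (I : choiceType) (s w : I -> nat) : locally_finite w ->
  - fps_gen s w = fps_gen (fun i => (s i).+1) w.
Proof.
move=> lfw; apply: fps_gen_uniq => N.
have [r r_uniq rN] := locally_finite_uniq N lfw.
exists r; split=> //.
under [X in fps_eqmod _ _ X]eq_bigr do rewrite exprS mulN1r mulNr.
rewrite sumrN => n ltnN; rewrite !fps_coefN; congr (- _).
exact: fps_gen_eqmod ltnN.
Qed.


End SignedGeneratingFunctions.

(** * Theta series *)

(** The product r (r - 1) is nonnegative for every integer r, so the absolute value loses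
    nothing. *)
Definition pronic (r : int) : nat := (`|(r * (r - 1))%R| %/ 2)%N.

Lemma pronicE r : (pronic r)%:Z * 2 = r * (r - 1).
Proof.
have nn : 0 <= r * (r - 1) by nia.
have dv : (2 %| `|(r * (r - 1))%R|)%N.
  by rewrite abszM dvdn2 oddM; lia.
have := divnK dv; rewrite -/(pronic r); lia.
Qed.

(* [B r (r - 1) / 2 + k r], written so that it is visibly a natural number *)
(* when [k <= B].                                                          *)
Definition theta_exp (B k : nat) (r : int) : nat :=
  (k * pronic (r + 1)%R + (B - k) * pronic r)%N.

Lemma theta_expE B k r : (k <= B)%N ->
  (theta_exp B k r)%:Z * 2 = B%:Z * (r * (r - 1)) + 2 * k%:Z * r.
Proof.
move=> leqkB; rewrite /theta_exp PoszD !PoszM -subzn // mulrDl -!mulrA !pronicE.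
ring.
Qed.

(** [pronic (r + 1)] and [pronic r] add up to r^2, and both enter the exponent with a positive
    multiplier. *)
Lemma theta_exp_ge B k r : (0 < k < B)%N -> (`|r| <= theta_exp B k r)%N.
Proof.
move=> /andP[k0 kB].
have p1 := pronicE (r + 1); have p2 := pronicE r.
have le1 : (pronic (r + 1)%R + pronic r <= theta_exp B k r)%N.
  by rewrite leq_add // leq_pmull // subn_gt0.
apply: leq_trans le1; nia.
Qed.

Lemma theta_exp_lf B k : (0 < B)%N -> (k <= B)%N -> locally_finite (theta_exp B k).
Proof.
move=> B0 lekB N.
(* For k = 0 or k = B the exponent can be smaller than |r|, so the window is slightly wider than
   N. *)
exists ([seq i%:Z | i <- iota 0 N.+2] ++ [seq - i%:Z | i <- iota 0 N.+2]) => r.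
move=> lt_r; have {lt_r} lt_r : (`|r| < N.+2)%N.
  have := theta_expE r lekB; nia.
rewrite mem_cat; apply/orP; case: r lt_r => r lt_r.
  by left; apply/mapP; exists r; rewrite ?mem_iota.
by right; apply/mapP; exists r.+1; rewrite ?mem_iota //; apply: NegzE.
Qed.

Section Theta.
Variable R : comUnitRingType.

Definition theta (B k : nat) : fps R := fps_gen R (fun=> 0%N) (theta_exp B k).
Definition alt_theta (B k : nat) : fps R := fps_gen R absz (theta_exp B k).

(* Split the lattice Z^2 by the parity of r + s, and rotate each half by 45 *)
(* degrees.                                                                 *)
Lemma alt_thetaM B m n : (0 < B)%N -> (m <= n)%N -> (m + n <= B)%N ->
  alt_theta B m * alt_theta B n =
  theta (2 * B)%N (m + n)%N * theta (2 * B)%N (B + n - m)%N -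
  fpsX R m * (theta (2 * B)%N (B + m + n)%N * theta (2 * B)%N (n - m)%N).
Proof.
move=> B0 lemn lemnB; have B20 : (0 < 2 * B)%N by lia.
have lf k : (k <= B)%N -> locally_finite (theta_exp B k) by apply: theta_exp_lf.
have lf2 k : (k <= 2 * B)%N -> locally_finite (theta_exp (2 * B)%N k).
  exact: theta_exp_lf.
have lf_even := locally_finite_pair (lf2 (m + n)%N ltac:(lia))
  (lf2 (B + n - m)%N ltac:(lia)).
have lf_odd := locally_finite_pair (lf2 (B + m + n)%N ltac:(lia))
  (lf2 (n - m)%N ltac:(lia)).
rewrite /alt_theta /theta !fps_genM; try by [apply: lf; lia|apply: lf2; lia].
rewrite fps_gen_shift // fps_genN; last first.
  by apply: locally_finite_le lf_odd => i; rewrite leq_addl.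
rewrite fps_genD //; last first.
  by apply: locally_finite_le lf_odd => i; rewrite leq_addl.
pose h (x : int * int + int * int) : int * int := match x with
  | inl p => (p.1 - p.2, p.1 + p.2) | inr p => (p.1 - p.2 + 1, p.1 + p.2) end.
have h_bij : bijective h.
  exists (fun p => if odd `|p.1 + p.2|
    then inr (((p.1 + p.2) %/ 2)%Z, ((p.2 - p.1 + 1) %/ 2)%Z)
    else inl (((p.1 + p.2) %/ 2)%Z, ((p.2 - p.1) %/ 2)%Z)).
    move=> [[u v]|[u v]] /=; case: ifPn => /= odd_uv; try lia.
      by congr (inl (_, _)); lia.
    by congr (inr (_, _)); lia.
  move=> [r s] /=; case: ifPn => /= odd_rs; congr (_, _); lia.
rewrite (fps_gen_reindex R _ h_bij); last first.
  by apply: locally_finite_pair; apply: lf; lia.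
apply: eq_fps_gen => [[[u v]|[u v]]|[[u v]|[u v]]] /=.
- lia.
- lia.
- have e1 := @theta_expE (2 * B)%N (B + n - m)%N v ltac:(lia).
  have e2 := @theta_expE (2 * B)%N (m + n)%N u ltac:(lia).
  have e3 := @theta_expE B n (u + v) ltac:(lia).
  have e4 := @theta_expE B m (u - v) ltac:(lia).
  rewrite -subzn in e1; last by lia.
  move: e1 e2 e3 e4.
  move: (theta_exp B m _) (theta_exp B n _) (theta_exp _ _ u) (theta_exp _ _ v).
  move=> a b c d e1 e2 e3 e4; suff : (a%:Z + b%:Z) * 2 = (c%:Z + d%:Z) * 2 by lia.
  by rewrite !mulrDl e1 e2 e3 e4 !PoszM !PoszD; ring.
- have e1 := @theta_expE (2 * B)%N (n - m)%N v ltac:(lia).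
  have e2 := @theta_expE (2 * B)%N (B + m + n)%N u ltac:(lia).
  have e3 := @theta_expE B n (u + v) ltac:(lia).
  have e4 := @theta_expE B m (u - v + 1) ltac:(lia).
  rewrite -subzn in e1; last by lia.
  move: e1 e2 e3 e4.
  move: (theta_exp B m _) (theta_exp B n _) (theta_exp _ _ u) (theta_exp _ _ v).
  move=> a b c d e1 e2 e3 e4.
  suff : (a%:Z + b%:Z) * 2 = (m%:Z + (c%:Z + d%:Z)) * 2 by lia.
  by rewrite !mulrDl e1 e2 e3 e4 !PoszM !PoszD; ring.
Qed.
End Theta.

(** * The Jacobi triple product *)

Section JacobiTripleProduct.
Variables (R : comUnitRingType) (B : nat).
Hypothesis B_gt0 : (0 < B)%N.

Definition qfact n : fps R := \prod_(0 <= i < n) (1 - fpsX R (B * i.+1)%N).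

(** The Gaussian binomial coefficient in base q^B; [qfact n] is (q^B; q^B)_n. *)
Definition qbinom n j : fps R :=
  if (j <= n)%N then qfact n / (qfact j * qfact (n - j)) else 0.

Lemma multipliable_1subX (e : nat -> nat) :
  (forall k, k < e k)%N -> fps_multipliable (fun k => 1 - fpsX R (e k)).
Proof.
move=> lt_e k n ltnk; rewrite fps_coefB /=.
by rewrite (ltn_eqF (leq_trans ltnk (lt_e k))) subr0.
Qed.

Lemma qfactS n : qfact n.+1 = qfact n * (1 - fpsX R (B * n.+1)%N).
Proof. by rewrite /qfact big_nat_recr. Qed.

Lemma qfact_eqmod n m N : (N <= n)%N -> (N <= m)%N ->
  fps_eqmod N.+1 (qfact n) (qfact m).
Proof.
by move=> ? ?; apply: fps_prod_eqmod => //; apply: multipliable_1subX => k; nia.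
Qed.

Lemma qfact_unit n : qfact n \is a GRing.unit.
Proof.
rewrite unfold_in /= /fps_unit (@qfact_eqmod n 0 0) //.
by rewrite /qfact big_geq // unitr1.
Qed.

Lemma qbinomE n j : (j <= n)%N ->
  qbinom n j * (qfact j * qfact (n - j)) = qfact n.
Proof. by move=> lejn; rewrite /qbinom lejn divrK // unitrM !qfact_unit. Qed.

Lemma qbinom_small n j : (n < j)%N -> qbinom n j = 0.
Proof. by rewrite /qbinom ltnNge; case: leqP. Qed.

Lemma qfact0 : qfact 0 = 1.
Proof. by rewrite /qfact big_geq. Qed.

Lemma qbinom0 n : qbinom n 0 = 1.
Proof.
apply: (mulIr (qfact_unit n)).
by rewrite mul1r -[RHS](qbinomE (leq0n n)) subn0 qfact0 mul1r.
Qed.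

Lemma qbinomn n : qbinom n n = 1.
Proof.
apply: (mulIr (qfact_unit n)).
by rewrite mul1r -[RHS](qbinomE (leqnn n)) subnn qfact0 mulr1.
Qed.

(** Over this common denominator, with a = q^(B(n-j)) and b = q^(B(j+1)), the two Pascal rules
    become 1 - ab = (1 - a) + a (1 - b) = (1 - b) + b (1 - a). *)
Lemma qbinomS_num n j : (j < n)%N ->
  [/\ qbinom n.+1 j.+1 * (qfact j.+1 * qfact (n - j)) =
        qfact n * (1 - fpsX R (B * (n - j))%N * fpsX R (B * j.+1)%N),
      qbinom n j.+1 * (qfact j.+1 * qfact (n - j)) =
        qfact n * (1 - fpsX R (B * (n - j))%N)
    & qbinom n j * (qfact j.+1 * qfact (n - j)) =
        qfact n * (1 - fpsX R (B * j.+1)%N)].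
Proof.
move=> ltjn; split.
- rewrite -[(n - j)%N in LHS]subSS qbinomE //; last by lia.
  by rewrite qfactS -fpsXD -mulnDr; congr (_ * (1 - fpsX _ (_ * _)%N)); lia.
- have -> : (n - j)%N = (n - j.+1).+1 by lia.
  by rewrite !qfactS -[qfact n](qbinomE ltjn) qfactS; ring.
- by rewrite qfactS -[qfact n](qbinomE (ltnW ltjn)); ring.
Qed.

Lemma qbinomSl n j : qbinom n.+1 j.+1 =
  qbinom n j.+1 + fpsX R (B * (n - j))%N * qbinom n j.
Proof.
case: (ltngtP j n) => [ltjn|ltnj|->].
- have [e1 e2 e3] := qbinomS_num ltjn.
  have U : qfact j.+1 * qfact (n - j) \is a GRing.unit by rewrite unitrM !qfact_unit.
  by apply: (mulIr U); rewrite mulrDl e1 e2 -mulrA e3; ring.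
- by rewrite !qbinom_small ?mulr0 ?addr0 //; lia.
- by rewrite !qbinomn qbinom_small // subnn muln0 fpsX0 mulr1 add0r.
Qed.

Lemma qbinomSr n j : qbinom n.+1 j.+1 =
  qbinom n j + fpsX R (B * j.+1)%N * qbinom n j.+1.
Proof.
case: (ltngtP j n) => [ltjn|ltnj|->].
- have [e1 e2 e3] := qbinomS_num ltjn.
  have U : qfact j.+1 * qfact (n - j) \is a GRing.unit by rewrite unitrM !qfact_unit.
  by apply: (mulIr U); rewrite mulrDl e1 e3 -mulrA e2; ring.
- by rewrite !qbinom_small ?mulr0 ?addr0 //; lia.
- by rewrite !qbinomn qbinom_small // mulr0 addr0.
Qed.

Variable k : nat.
Hypothesis k_int : (0 < k < B)%N.

Let T (r : int) : fps R := (-1) ^+ `|r|%N * fpsX R (theta_exp B k r).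

(** Consecutive theta exponents differ by B r + k, which may be negative; i and j carry this
    difference on the two sides. *)
Let T_step (r : int) (i j : nat) : i%:Z = j%:Z + B%:Z * r + k%:Z ->
  fpsX R j * T (r + 1) = - (fpsX R i * T r).
Proof.
move=> ijr; have lekB : (k <= B)%N by lia.
have [e1 e2] := (theta_expE (r + 1) lekB, theta_expE r lekB).
have e : (j + theta_exp B k (r + 1) = i + theta_exp B k r)%N.
  move: e1 e2; move: (theta_exp B k (r + 1)) (theta_exp B k r) => a b e1 e2.
  suff : (j%:Z + a%:Z) * 2 = (i%:Z + b%:Z) * 2 by lia.
  by rewrite !mulrDl e1 e2 ijr; ring.
rewrite /T !(mulrCA (fpsX _ _)) -!fpsXD e -mulNr; congr (_ * _).
by rewrite -signr_odd -[in RHS]signr_odd -signrN; congr ((-1) ^+ nat_of_bool _); lia.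
Qed.

Let sum_qbinom n (F : nat -> fps R) :
  \sum_(j < n.+1) qbinom n j * F j =
  F 0%N + \sum_(j < n.+1) qbinom n j.+1 * F j.+1.
Proof.
rewrite big_ord_recl [in RHS]big_ord_recr /= qbinom0 mul1r.
by rewrite qbinom_small // mul0r addr0.
Qed.

(** Both kinds of factors are added one at a time. A new factor matches one Pascal rule, [qbinomSr]
    for n and [qbinomSl] for m, once [T_step] has absorbed its monomial. *)
Lemma finite_triple_product m n :
  (\prod_(0 <= i < m) (1 - fpsX R (B * i + k)%N)) *
  (\prod_(0 <= i < n) (1 - fpsX R (B * i + (B - k))%N)) =
  \sum_(j < (m + n).+1) qbinom (m + n) j * T (j%:Z - n%:Z).
Proof.
elim: n => [|n IHn]; last first.
  rewrite big_nat_recr //= mulrA {}IHn addnS mulrBr mulr1.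
  rewrite [RHS](_ : _ = T (- n.+1%:Z) + \sum_(j < (m + n).+1)
    (qbinom (m + n) j * T (j%:Z - n%:Z) +
     qbinom (m + n) j.+1 * (fpsX R (B * j.+1)%N * T (j%:Z - n%:Z)))); last first.
    rewrite big_ord_recl qbinom0 mul1r; congr (_ + _).
      exact: (congr1 T (sub0r _)).
    apply: eq_bigr => j _; rewrite lift0.
    rewrite (_ : j.+1%:Z - n.+1%:Z = j%:Z - n%:Z); last by lia.
    by rewrite qbinomSr; ring.
  rewrite big_split /= addrCA; congr (_ + _).
  (* Shifting j by one turns the remaining terms into the contribution of the monomial q^(Bn+B-k) of
     the new factor. *)
  have <- : \sum_(j < (m + n).+1) qbinom (m + n) j *
      (fpsX R (B * j)%N * T (j%:Z - n.+1%:Z)) = T (- n.+1%:Z) +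
      \sum_(j < (m + n).+1) qbinom (m + n) j.+1 *
        (fpsX R (B * j.+1)%N * T (j%:Z - n%:Z)).
    rewrite (sum_qbinom _ (fun j => fpsX R (B * j)%N * T (j%:Z - n.+1%:Z))).
    rewrite muln0 fpsX0 mul1r (sub0r n.+1%:Z); congr (_ + _).
    by apply: eq_bigr => j _; congr (_ * (_ * T _)); lia.
  rewrite mulr_suml -sumrN; apply: eq_bigr => j _.
  have := @T_step (j%:Z - n.+1%:Z) (B * j)%N (B * n + (B - k))%N ltac:(nia).
  rewrite (_ : j%:Z - n.+1%:Z + 1 = j%:Z - n%:Z); last by lia.
  by move=> e; rewrite -mulrA [T _ * _]mulrC e mulrN opprK.
rewrite [X in _ * X]big_geq // mulr1 addn0.
elim: m => [|m IHm].
  rewrite big_geq // big_ord1 qbinom0 mul1r /T.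
  by rewrite /theta_exp /= muln0 addn0 muln0 fpsX0 mul1r.
rewrite big_nat_recr //= {}IHm mulrBr mulr1 [RHS]big_ord_recl qbinom0 mul1r.
rewrite [X in X - _ = _](sum_qbinom m (fun j => T (j%:Z - 0%:Z))) -addrA; congr (_ + _).
rewrite mulr_suml -sumrB; apply: eq_bigr => j _.
rewrite lift0 (subr0 j%:Z) (subr0 j.+1%:Z).
rewrite qbinomSl mulrDl; congr (_ + _).
have := @T_step j%:Z (B * m + k)%N (B * (m - j))%N ltac:(have := ltn_ord j; nia).
rewrite (_ : j%:Z + 1 = j.+1%:Z); last by lia.
by move=> e; rewrite [RHS]mulrAC e; ring.
Qed.
(** The indices n, 2n, n + r and n - r of the q-factorials involved are all at least n - |r|, so
    numerator and denominator agree to that order. *)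
Lemma qfact_qbinom_eqmod n (r : int) : (`|r| <= n)%N ->
  fps_eqmod (n - `|r|).+1 (qfact n * qbinom (n + n) `|(n%:Z + r)%R|%N) 1.
Proof.
move=> lern; set j := `|(n%:Z + r)%R|%N; have lej : (j <= n + n)%N by lia.
have U : qfact j * qfact (n + n - j) \is a GRing.unit by rewrite unitrM !qfact_unit.
have -> : qfact n * qbinom (n + n) j =
    (qfact n * qfact (n + n)) * (qfact j * qfact (n + n - j))^-1.
  by apply: (mulIr U); rewrite divrK // -mulrA qbinomE.
rewrite -(divrr U); apply: fps_eqmodM => //.
have [r_ge0|r_lt0] := leP 0 r.
  by rewrite mulrC; apply: fps_eqmodM; apply: qfact_eqmod; lia.
by apply: fps_eqmodM; apply: qfact_eqmod; lia.
Qed.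

(** The limit of the finite form with m = n, multiplied by (q^B; q^B)_n. *)
Theorem jacobi_triple_product :
  fps_iprod (fun i => 1 - fpsX R (B * i + k)%N) *
  fps_iprod (fun i => 1 - fpsX R (B * i + (B - k))%N) *
  fps_iprod (fun i => 1 - fpsX R (B * i.+1)%N) = alt_theta R B k.
Proof.
apply: fps_gen_uniq => n; exists [seq j%:Z - n%:Z | j <- iota 0 (n + n).+1].
split.
- by rewrite map_inj_uniq ?iota_uniq // => i j; lia.
- move=> r lt_r; have le_r := leq_ltn_trans (theta_exp_ge r k_int) lt_r.
  by apply/mapP; exists `|(n%:Z + r)%R|%N; rewrite ?mem_iota; lia.
apply: (@fps_eqmodW _ n.+1) => //.
apply: fps_eqmod_trans.
  by do 2?apply: fps_eqmodM; apply: (fps_iprod_eqmod (K := n)) => //;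
    apply: multipliable_1subX => i; nia.
rewrite finite_triple_product -/(qfact n) mulr_suml big_map.
rewrite -[iota _ _]/(index_iota 0 (n + n).+1) big_mkord.
apply: fps_eqmod_sum => j.
set r := j%:Z - n%:Z; have ler : (`|r| <= n)%N by have := ltn_ord j; lia.
have -> : qbinom (n + n) j * T r * qfact n = (-1) ^+ `|r| *
    (fpsX R (theta_exp B k r) * (qfact n * qbinom (n + n) `|(n%:Z + r)%R|)).
  by rewrite (_ : `|(n%:Z + r)%R|%N = j); [rewrite /T; ring|lia].
apply: fps_eqmodM => //.
rewrite -[X in fps_eqmod _ _ X]mulr1.
(* The precision |r| lost in the q-binomial is regained because [T r] is divisible by q^|r|. *)
apply: (@fps_eqmodW _ (theta_exp B k r + (n - `|r|).+1)%N).
  by have := theta_exp_ge r k_int; lia.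
exact/fps_eqmodXM/qfact_qbinom_eqmod.
Qed.

End JacobiTripleProduct.

(** * Eta quotients of level 12 *)

Definition fps_poly (R : comUnitRingType) (p : {poly R}) : fps R :=
  FPS (fun n => p`_n).

Lemma fps_polyM (R : comUnitRingType) (p q : {poly R}) :
  fps_poly (p * q) = fps_poly p * fps_poly q.
Proof. by apply: fpsP => n; rewrite fps_coefM /= coefM. Qed.

Lemma fps_poly1 (R : comUnitRingType) : fps_poly 1 = 1 :> fps R.
Proof. by apply: fpsP => n /=; rewrite coef1. Qed.

(* (q^k; q^B)_oo *)
Definition qpoch (B k : nat) : fps int :=
  fps_iprod (fun i => 1 - fpsX int (B * i + k)%N).

Lemma qpoch_multipliable B k : (0 < B)%N -> (0 < k)%N ->
  fps_multipliable (fun i => 1 - fpsX int (B * i + k)%N).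
Proof. by move=> ? ?; apply: multipliable_1subX => i; nia. Qed.

Lemma euler_qpoch j : euler j = qpoch j j.
Proof.
apply: fpsP => n; rewrite /= /qpoch /=.
rewrite -[LHS]/(fps_poly _ n) (big_morph _ (@fps_polyM _) (@fps_poly1 _)).
rewrite big_add1 /=; congr (fps_coef _ n); apply: eq_bigr => i _.
apply: fpsP => m; rewrite fps_coefB /= coefB coef1 coefXn mulnS addnC.
by [].
Qed.

Lemma euler_regroup d m : (0 < d)%N -> (0 < m)%N ->
  euler d = \prod_(r < m) qpoch (d * m) (d * r.+1).
Proof.
move=> d0 m0; rewrite euler_qpoch /qpoch (fps_iprod_regroup m0) //; last first.
  exact: qpoch_multipliable.
apply: eq_bigr => r _; apply: eq_fps_iprod => i; congr (1 - fpsX _ _); lia.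
Qed.

Lemma dil_euler d j : (0 < d)%N -> (0 < j)%N -> fps_dil d (euler j) = euler (d * j)%N.
Proof.
move=> d0 j0; rewrite !euler_qpoch fps_dil_iprod //; last exact: qpoch_multipliable.
apply: eq_fps_iprod => i; rewrite fps_dilB fps_dil1 // fps_dilX //.
by congr (1 - fpsX _ _); lia.
Qed.

Lemma alt_theta_qpoch B k : (0 < k < B)%N ->
  alt_theta int B k = qpoch B k * qpoch B (B - k) * euler B.
Proof.
move=> kB; rewrite -jacobi_triple_product //; last by lia.
by rewrite euler_qpoch; congr (_ * _); apply: eq_fps_iprod => i; rewrite mulnS addnC.
Qed.

Lemma fpsX_exp n : fpsX int n = fpsX int 1 ^+ n.
Proof. by elim: n => [|n IHn]; rewrite ?fpsX0 // exprS -IHn -fpsXD. Qed.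

(* Up to a power of q, each product of two of these thetas is a 2x2 minor of *)
(* the 2x4 matrix with columns [(theta 24 (2x), q^x theta 24 (12 + 2x))],    *)
(* x in {0, 2, 3, 4}, so this is the Pluecker relation.                      *)
Lemma alt_theta12_plucker :
  alt_theta int 12 2 * alt_theta int 12 6 * alt_theta int 12 3 ^+ 2 =
  alt_theta int 12 1 * alt_theta int 12 5 *
  (alt_theta int 12 4 ^+ 2 + fpsX int 1 * alt_theta int 12 2 ^+ 2).
Proof.
set J := alt_theta int 12; set q := fpsX int 1; pose t := theta int 24.
(* The symmetry k -> 12 - k gives J_1 J_5 a second expansion, which is the one needed next to
   J_2^2. *)
have J57 : J 5 = J 7 by rewrite /J !alt_theta_qpoch //= [qpoch 12 5 * _]mulrC.
have JM m n : (m <= n)%N -> (m + n <= 12)%N -> J m * J n =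
    t (m + n)%N * t (12 + n - m)%N - q ^+ m * (t (12 + m + n)%N * t (n - m)%N).
  by move=> lemn lemn12; rewrite /J alt_thetaM // (fpsX_exp m).
have e15 : J 1 * J 5 = t 6 * t 16 - q * (t 18 * t 4) := JM 1 5 isT isT.
have e17 : J 1 * J 7 = t 8 * t 18 - q * (t 20 * t 6) := JM 1 7 isT isT.
have e44 : J 4 * J 4 = t 8 * t 12 - q ^+ 4 * (t 20 * t 0) := JM 4 4 isT isT.
have e33 : J 3 * J 3 = t 6 * t 12 - q ^+ 3 * (t 18 * t 0) := JM 3 3 isT isT.
have e26 : J 2 * J 6 = t 8 * t 16 - q ^+ 2 * (t 20 * t 4) := JM 2 6 isT isT.
have e22 : J 2 * J 2 = t 4 * t 12 - q ^+ 2 * (t 16 * t 0) := JM 2 2 isT isT.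
have {}e17 : J 1 * J 5 = t 8 * t 18 - q * (t 20 * t 6) by rewrite J57.
by rewrite mulrDr [in X in _ + X]e17 !expr2 e15 e44 e33 e26 e22; ring.
Qed.

(** * Exponent calculus for eta quotients *)

Lemma euler_exp_unit j (z : int) : euler j ^ z \is a GRing.unit.
Proof. by rewrite unitrXz // euler_unit. Qed.

(** The indices are the divisors of 12. Locking leaves only the exponents to compare, so identities
    between quotients close by integer computation. *)
HB.lock Definition etaq (t1 t2 t3 t4 t6 t12 : int) : fps int :=
  euler 1 ^ t1 * euler 2 ^ t2 * euler 3 ^ t3 * euler 4 ^ t4 * euler 6 ^ t6 *
  euler 12 ^ t12.

Lemma etaqE a b c d e f : etaq a b c d e f =
  euler 1 ^ a * euler 2 ^ b * euler 3 ^ c * euler 4 ^ d * euler 6 ^ e *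
  euler 12 ^ f.
Proof. by rewrite etaq.unlock. Qed.

Lemma etaqM a b c d e f a' b' c' d' e' f' :
  etaq a b c d e f * etaq a' b' c' d' e' f' =
  etaq (a + a') (b + b') (c + c') (d + d') (e + e') (f + f').
Proof. by rewrite !etaqE !exprzDr ?euler_unit //; ring. Qed.

Lemma etaq0 : etaq 0 0 0 0 0 0 = 1.
Proof. by rewrite etaqE !expr0z !mulr1. Qed.

Lemma etaq_unit a b c d e f : etaq a b c d e f \is a GRing.unit.
Proof. by rewrite etaqE !unitrM !euler_exp_unit. Qed.

Lemma euler1_etaq : euler 1 = etaq 1 0 0 0 0 0.
Proof. by rewrite etaqE !expr0z expr1z !mulr1. Qed.
Lemma euler2_etaq : euler 2 = etaq 0 1 0 0 0 0.
Proof. by rewrite etaqE !expr0z expr1z !mulr1 mul1r. Qed.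
Lemma euler3_etaq : euler 3 = etaq 0 0 1 0 0 0.
Proof. by rewrite etaqE !expr0z expr1z !mulr1 !mul1r. Qed.
Lemma euler4_etaq : euler 4 = etaq 0 0 0 1 0 0.
Proof. by rewrite etaqE !expr0z expr1z !mulr1 !mul1r. Qed.
Lemma euler6_etaq : euler 6 = etaq 0 0 0 0 1 0.
Proof. by rewrite etaqE !expr0z expr1z !mulr1 !mul1r. Qed.
Lemma euler12_etaq : euler 12 = etaq 0 0 0 0 0 1.
Proof. by rewrite etaqE !expr0z expr1z !mul1r. Qed.

Definition euler_etaqE := (euler1_etaq, euler2_etaq, euler3_etaq, euler4_etaq,
  euler6_etaq, euler12_etaq).

(** Clears denominators: the explicit exponents supplied at each use are those of the multiplier,
    then those of the product. *)
Lemma etaq_div (x : fps int) a b c d e f a' b' c' d' e' f' :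
  x * etaq a b c d e f = etaq a' b' c' d' e' f' ->
  x = etaq (a' - a) (b' - b) (c' - c) (d' - d) (e' - e) (f' - f).
Proof.
move=> xE; apply: (mulIr (etaq_unit a b c d e f)).
by rewrite xE etaqM !subrK.
Qed.

Lemma euler12_factors : let E := qpoch 12 in
  [/\ euler 1 = E 1%N * E 2%N * E 3%N * E 4%N * E 5%N * E 6%N * E 7%N * E 8%N * E 9%N *
        E 10%N * E 11%N * euler 12,
      euler 2 = E 2%N * E 4%N * E 6%N * E 8%N * E 10%N * euler 12,
      euler 3 = E 3%N * E 6%N * E 9%N * euler 12,
      euler 4 = E 4%N * E 8%N * euler 12 &
      euler 6 = E 6%N * euler 12].
Proof.
split; [rewrite (@euler_regroup 1 12)|rewrite (@euler_regroup 2 6)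
  |rewrite (@euler_regroup 3 4)|rewrite (@euler_regroup 4 3)
  |rewrite (@euler_regroup 6 2)] => //.
all: by rewrite !big_ord_recr big_ord0 /= mul1r (euler_qpoch 12).
Qed.

(** With denominators cleared, each claim compares products of the [qpoch 12 r]. The thetas J_1 and
    J_5 enter together because the residues prime to 12 are 1, 5, 7, 11. *)
Lemma alt_theta12_etaq :
  [/\ alt_theta int 12 1 * alt_theta int 12 5 = etaq 1 (-1) (-1) 0 1 2,
      alt_theta int 12 2 = etaq 0 1 0 (-1) (-1) 2,
      alt_theta int 12 3 = etaq 0 0 1 0 (-1) 1,
      alt_theta int 12 4 = etaq 0 0 0 1 0 0 &
      alt_theta int 12 6 = etaq 0 0 0 0 2 (-1)].
Proof.
have [e1 e2 e3 e4 e6] := euler12_factors.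
rewrite !alt_theta_qpoch //= !subSS !subn0; split.
- apply: (@etaq_div _ 0 1 1 0 0 0 1 0 0 0 1 2).
  transitivity (euler 1 * euler 6 * euler 12 ^+ 2); last first.
    by rewrite !euler_etaqE expr2 !etaqM.
  rewrite -[etaq _ _ _ _ _ _](_ : euler 2 * euler 3 = _); last first.
    by rewrite !euler_etaqE !etaqM.
  by rewrite e1 e2 e3 e6; ring.
- apply: (@etaq_div _ 0 0 0 1 1 0 0 1 0 0 0 2).
  transitivity (euler 2 * euler 12 ^+ 2); last first.
    by rewrite !euler_etaqE expr2 !etaqM.
  rewrite -[etaq _ _ _ _ _ _](_ : euler 4 * euler 6 = _); last first.
    by rewrite !euler_etaqE !etaqM.
  by rewrite e2 e4 e6; ring.
- apply: (@etaq_div _ 0 0 0 0 1 0 0 0 1 0 0 1).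
  transitivity (euler 3 * euler 12); last by rewrite !euler_etaqE !etaqM.
  by rewrite -euler6_etaq e3 e6; ring.
- by rewrite -euler4_etaq e4; ring.
- apply: (@etaq_div _ 0 0 0 0 0 1 0 0 0 0 2 0).
  transitivity (euler 6 ^+ 2); last by rewrite !euler_etaqE expr2 !etaqM.
  by rewrite -euler12_etaq e6; ring.
Qed.

Lemma morph_exprz (phi : fps int -> fps int) : phi 1 = 1 ->
  (forall f g, phi (f * g) = phi f * phi g) ->
  forall f (z : int), f \is a GRing.unit -> phi (f ^ z) = phi f ^ z.
Proof.
move=> phi1 phiM f z Uf.
have phiX n : phi (f ^+ n) = phi f ^+ n.
  by elim: n => [|n IHn]; rewrite ?phi1 // !exprS phiM IHn.
have phif_unit : phi f \is a GRing.unit.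
  by apply/unitrP; exists (phi f^-1); rewrite -!phiM mulVr ?divrr.
case: z => n; first exact: phiX.
have Ufn : f ^+ n.+1 \is a GRing.unit by rewrite unitrX.
rewrite NegzE -!exprnN; apply: (mulIr (_ : phi f ^+ n.+1 \is a GRing.unit)).
  by rewrite unitrX.
by rewrite mulVr ?unitrX // -phiX -phiM mulVr.
Qed.

Lemma etaqX a b c d e f z :
  etaq a b c d e f ^ z = etaq (a * z) (b * z) (c * z) (d * z) (e * z) (f * z).
Proof.
have mulX (x y : fps int) : x \is a GRing.unit -> y \is a GRing.unit ->
    (x * y) ^ z = x ^ z * y ^ z.
  by move=> Ux Uy; apply: exprMz_comm => //; apply: mulrC.
by rewrite !etaqE !mulX ?unitrM ?euler_exp_unit // !exprz_exp.
Qed.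

(** The exponents of f_4 and f_12 vanish because q -> q^2 would produce f_8 and f_24. *)
Lemma dil2_etaq a b c e :
  fps_dil 2 (etaq a b c 0 e 0) = etaq 0 a 0 b c e.
Proof.
have dilM (f g : fps int) := fps_dilM f g (ltn0Sn 1).
have dilX := morph_exprz (fps_dil1 _ (ltn0Sn 1)) dilM.
rewrite !etaqE !dilM !dilX ?euler_unit // !dil_euler // !expr0z.
by rewrite !mulr1 !mul1r.
Qed.

(** * Eta quotients under q -> -q *)

Lemma neg_euler2 : fps_neg (euler 2) = euler 2.
Proof. by rewrite -(@dil_euler 2 1) // fps_neg_dil. Qed.
Lemma neg_euler4 : fps_neg (euler 4) = euler 4.
Proof. by rewrite -(@dil_euler 4 1) // fps_neg_dil. Qed.
Lemma neg_euler6 : fps_neg (euler 6) = euler 6.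
Proof. by rewrite -(@dil_euler 6 1) // fps_neg_dil. Qed.
Lemma neg_euler12 : fps_neg (euler 12) = euler 12.
Proof. by rewrite -(@dil_euler 12 1) // fps_neg_dil. Qed.

Lemma euler_split2 j : (0 < j)%N -> euler j = qpoch (2 * j) j * euler (2 * j).
Proof.
move=> j0; rewrite (@euler_regroup j 2) // !big_ord_recr big_ord0 /= mul1r.
by rewrite !euler_qpoch; congr (qpoch _ _ * qpoch _ _); lia.
Qed.

Lemma neg_qpoch_odd :
  fps_neg (qpoch 2 1) = fps_iprod (fun i => 1 + fpsX int (2 * i + 1)%N).
Proof.
rewrite /qpoch fps_neg_iprod; apply: eq_fps_iprod => i.
by rewrite fps_negB fps_neg1 fps_negX -signr_odd oddD oddM /= expr1 mulN1r opprK.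
Qed.

(** Multiplying (1 + q^(2i+1)) (1 - q^(2i+1)) = 1 - q^(4i+2) over i gives (-q; q^2)_oo (q; q^2)_oo =
    (q^2; q^4)_oo. *)
Lemma neg_euler1M : fps_neg (euler 1) * (euler 1 * euler 4) = euler 2 ^+ 3.
Proof.
have negM : fps_neg (qpoch 2 1) * qpoch 2 1 = qpoch 4 2.
  rewrite neg_qpoch_odd /qpoch -fps_iprodM; first last.
  - exact: qpoch_multipliable.
  - move=> k n ltnk; rewrite fps_coefD /=.
    have lt_n : (n < 2 * k + 1)%N by lia.
    by rewrite (ltn_eqF lt_n) addr0.
  apply: eq_fps_iprod => i; rewrite mulrDl mul1r mulrBr mulr1 -fpsXD.
  rewrite addrA subrK; congr (1 - fpsX _ _); lia.
have e1 : euler 1 = qpoch 2 1 * euler 2 := @euler_split2 1 isT.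
have e2 : euler 2 = qpoch 4 2 * euler 4 := @euler_split2 2 isT.
rewrite e1 fps_negM neg_euler2.
transitivity (fps_neg (qpoch 2 1) * qpoch 2 1 * euler 4 * euler 2 ^+ 2); first by ring.
by rewrite negM -e2 -exprS.
Qed.

Lemma neg_euler1 : fps_neg (euler 1) = etaq (-1) 3 0 (-1) 0 0.
Proof.
apply: (@etaq_div _ 1 0 0 1 0 0 0 3 0 0 0 0).
transitivity (fps_neg (euler 1) * (euler 1 * euler 4)).
  by congr (_ * _); rewrite !euler_etaqE etaqM.
by rewrite neg_euler1M euler2_etaq !exprS expr0 mulr1 !etaqM.
Qed.

Lemma neg_euler3 : fps_neg (euler 3) = etaq 0 0 (-1) 0 3 (-1).
Proof.
apply: (@etaq_div _ 0 0 1 0 0 1 0 0 0 0 3 0).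
transitivity (fps_dil 3 (fps_neg (euler 1) * (euler 1 * euler 4))).
  rewrite !fps_dilM // -fps_neg_dil_odd // !dil_euler //.
  by congr (_ * _); rewrite !euler_etaqE etaqM.
by rewrite neg_euler1M !exprS expr0 mulr1 !fps_dilM // dil_euler // euler6_etaq !etaqM.
Qed.

Lemma neg_etaq a b c d e f : fps_neg (etaq a b c d e f) =
  etaq (- a) (b + 3 * a) (- c) (d - a) (e + 3 * c) (f - c).
Proof.
have negX := morph_exprz (fps_neg1 _) (@fps_negM _).
rewrite [in LHS]etaqE !fps_negM !negX ?euler_unit //.
rewrite neg_euler1 neg_euler2 neg_euler3 neg_euler4 neg_euler6 neg_euler12.
rewrite !euler_etaqE.
rewrite !etaqX.
rewrite !etaqM.
by congr etaq; ring.
Qed.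

(* [v = q (psi (q^6) / psi (q^2))^2], a Hauptmodul for Gamma_0(12) *)
Definition hauptmodul12 : fps int := fpsX int 1 * etaq 0 2 0 (-4) (-2) 4.
Local Notation v := hauptmodul12.

(** This is [alt_theta12_plucker] divided by J_1 J_5 J_4^2, since v = q J_2^2 / J_4^2. *)
Lemma one_plus_v : 1 + v = etaq (-1) 2 3 (-3) (-2) 1.
Proof.
apply: (@etaq_div _ 1 (-1) (-1) 2 1 2 0 1 2 (-1) (-1) 3).
have [e15 e2 e3 e4 e6] := alt_theta12_etaq.
have := alt_theta12_plucker.
rewrite e15 e2 e3 e4 e6 !expr2 mulrDr (mulrCA _ (fpsX _ _)) !etaqM => plucker.
rewrite mulrDl mul1r -mulrA etaqM; exact: esym plucker.
Qed.

Lemma one_minus_v : 1 - v = etaq 1 (-1) (-3) (-2) 7 (-2).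
Proof.
have := congr1 (@fps_neg _) one_plus_v.
by rewrite fps_negD fps_neg1 fps_negM fps_negX expr1 !mulN1r mulNr !neg_etaq.
Qed.

Lemma one_plus_3v : 1 + 3 * v = etaq (-3) 9 1 (-6) (-3) 2.
Proof.
pose u : fps int := fpsX int 1 * etaq 4 (-8) (-4) 0 8 0.
have one_minus_u : 1 - u = etaq 1 (-5) 5 0 (-1) 0.
  (* At q^2 the claim reads 1 - v^2 = (1 - v)(1 + v), with both factors known. *)
  apply: (@fps_dil_inj _ 2) => //; rewrite dil2_etaq fps_dilB fps_dil1 //.
  rewrite fps_dilM // fps_dilX // dil2_etaq (fpsX_exp (2 * 1)).
  transitivity ((1 - v) * (1 + v)); last first.
    by rewrite one_minus_v one_plus_v etaqM.
  transitivity (1 - v ^+ 2); last by ring.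
  by rewrite exprMn [etaq _ _ _ _ _ _ ^+ 2]expr2 etaqM.
set T := etaq _ _ _ _ _ _.
have uT : u * T = v * (1 - v) by rewrite one_minus_v /v -!mulrA !etaqM.
have one_minus_uT : (1 - u) * T = (1 + v) ^+ 2.
  by rewrite one_minus_u one_plus_v expr2 !etaqM.
(* The two known products add up to v (1 - v) + (1 + v)^2 = 1 + 3v. *)
transitivity (u * T + (1 - u) * T); last by ring.
by rewrite uT one_minus_uT; ring.
Qed.

(** * Positivity *)

Definition fps_pos (f : fps int) := forall n, 0 < f n.
(* The condition on the constant term makes [fps_posM] strict. *)
Definition fps_nneg (f : fps int) := 0 < f 0%N /\ forall n, 0 <= f n.

Lemma fps_posW f : fps_pos f -> fps_nneg f.
Proof. by move=> fP; split=> // n; apply: ltW. Qed.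

Lemma fps_nnegM f g : fps_nneg f -> fps_nneg g -> fps_nneg (f * g).
Proof.
move=> [f0 fP] [g0 gP]; split=> [|n]; rewrite fps_coefM.
  by rewrite big_ord1 subnn mulr_gt0.
by apply: sumr_ge0 => i _; apply: mulr_ge0.
Qed.

Lemma fps_posM f g : fps_pos f -> fps_nneg g -> fps_pos (f * g).
Proof.
move=> fP [g0 gP] n; rewrite fps_coefM big_ord_recr /= subnn.
apply: ltr_wpDl; last exact: mulr_gt0.
by apply: sumr_ge0 => i _; apply: mulr_ge0 => //; apply: ltW.
Qed.

Lemma fps_nneg_dil d f : fps_nneg f -> fps_nneg (fps_dil d f).
Proof.
move=> [f0 fP]; split=> [|n] /=; first by rewrite dvdn0 div0n.
by case: ifP.
Qed.

Lemma fps_nneg_iprod (u : nat -> fps int) :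
  (forall k, fps_nneg (u k)) -> fps_nneg (fps_iprod u).
Proof.
move=> uP; split=> [|n]; first by rewrite fps_iprod_coef0.
suff : fps_nneg (\prod_(0 <= k < n) u k) by case=> _ /(_ n).
elim/big_rec: _ => [|k f _ fP]; last exact: fps_nnegM.
by split=> // m; rewrite fps_coef1.
Qed.

Lemma fps_pos_iprod (u : nat -> fps int) : fps_multipliable u ->
  fps_pos (u 0%N) -> (forall k, fps_nneg (u k.+1)) -> fps_pos (fps_iprod u).
Proof.
move=> mu u0 uP; rewrite fps_iprod_recl //; apply: fps_posM => //.
exact: fps_nneg_iprod.
Qed.

Definition fps_geo m : fps int := FPS (fun n => (m %| n)%N%:R).

Lemma fps_geoM m : (0 < m)%N -> (1 - fpsX int m) * fps_geo m = 1.
Proof.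
move=> m0; apply: fpsP => n; rewrite mulrBl mul1r fps_coefB fps_coefXM fps_coef1 /=.
case: leqP => [lemn|ltnm].
  have -> : (n == 0)%N = false by lia.
  by rewrite dvdn_subl // subrr.
by case: n ltnm => [|n] ltnm; rewrite ?dvdn0 ?subr0 // gtnNdvd.
Qed.

Lemma fps_geo_eqmod m : fps_eqmod m (fps_geo m) 1.
Proof.
by move=> [|n] ltnm; rewrite fps_coef1 /= ?dvdn0 // gtnNdvd.
Qed.

Lemma fps_geo_nneg m : fps_nneg (fps_geo m).
Proof. by split=> [|n] /=; rewrite ?dvdn0 ?ler0n. Qed.

Lemma fps_multipliable_geo (e : nat -> nat) : (forall k, k < e k)%N ->
  fps_multipliable (fun k => fps_geo (e k)).
Proof. by move=> lt_e k; apply: fps_eqmodW (lt_e k) (@fps_geo_eqmod (e k)). Qed.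

(** * Eta quotients with positive or nonnegative coefficients *)

(** The quotient is 1 / (q; q^2)_oo, and its factor 1 / (1 - q) already has all coefficients equal
    to 1. *)
Lemma f2_over_f1_pos : fps_pos (etaq (-1) 1 0 0 0 0).
Proof.
have mg : fps_multipliable (fun i => fps_geo (2 * i + 1)%N).
  by apply: fps_multipliable_geo => k; lia.
suff <- : fps_iprod (fun i => fps_geo (2 * i + 1)%N) = etaq (-1) 1 0 0 0 0.
  apply: fps_pos_iprod; first exact: mg.
    by move=> n /=; rewrite dvd1n.
  by move=> k; apply: fps_geo_nneg.
apply: (@etaq_div _ 1 0 0 0 0 0 0 1 0 0 0 0).
rewrite -euler1_etaq -euler2_etaq (@euler_split2 1) // mulrA -fps_iprodM //; last first.
  exact: qpoch_multipliable.
rewrite (eq_fps_iprod (v := fun=> 1)) ?fps_iprod1 ?mul1r // => i.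
by rewrite mulrC fps_geoM //; lia.
Qed.

Lemma inv_f1_nneg : fps_nneg (etaq (-1) 0 0 0 0 0).
Proof.
have mg : fps_multipliable (fun i => fps_geo (1 * i + 1)%N).
  by apply: fps_multipliable_geo => k; lia.
suff <- : fps_iprod (fun i => fps_geo (1 * i + 1)%N) = etaq (-1) 0 0 0 0 0.
  by apply: fps_nneg_iprod => k; apply: fps_geo_nneg.
apply: (@etaq_div _ 1 0 0 0 0 0 0 0 0 0 0 0).
rewrite -euler1_etaq etaq0 euler_qpoch -fps_iprodM //; last first.
  exact: qpoch_multipliable.
rewrite (eq_fps_iprod (v := fun=> 1)) ?fps_iprod1 // => i.
by rewrite mulrC fps_geoM //; lia.
Qed.

(** The quotient is (-q; q^2)_oo, which counts partitions into distinct odd parts. *)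
Lemma distinct_odd_nneg : fps_nneg (etaq (-1) 2 0 (-1) 0 0).
Proof.
suff <- : fps_neg (qpoch 2 1) = etaq (-1) 2 0 (-1) 0 0.
  rewrite neg_qpoch_odd; apply: fps_nneg_iprod => k; split=> [|n].
    by rewrite fps_coefD /= addn1.
  by rewrite fps_coefD /= addr_ge0 ?ler0n.
apply: (@etaq_div _ 0 1 0 0 0 0 (-1) 3 0 (-1) 0 0).
by rewrite -neg_euler1 -euler2_etaq -[in LHS]neg_euler2 -fps_negM -(@euler_split2 1).
Qed.

(* With a = q^(3k+1) and b = q^(3k+2), the k-th factor of the product is     *)
(* (1 - ab) / ((1 - a)(1 - b)) = 1 / (1 - b) + a / (1 - a).                  *)
Lemma f3_sqr_over_f1_f6_pos : fps_pos (etaq (-1) 0 2 0 (-1) 0).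
Proof.
pose u i := fps_geo (3 * i + 2)%N + fpsX int (3 * i + 1)%N * fps_geo (3 * i + 1)%N.
have mu : fps_multipliable u.
  move=> k n ltnk; rewrite fps_coefD fps_coefXM ifN ?addr0; last by lia.
  by rewrite (@fps_geo_eqmod (3 * k + 2)) //; lia.
suff <- : fps_iprod u = etaq (-1) 0 2 0 (-1) 0.
  apply: fps_pos_iprod; first exact: mu.
    move=> n; rewrite /u fps_coefD fps_coefXM /=; case: n => [|n] //=.
    by rewrite dvd1n ltr_wpDl ?ler0n.
  move=> k; split=> [|n]; rewrite fps_coefD fps_coefXM.
    by rewrite addn1.
  by rewrite addr_ge0 ?ler0n //; case: ifP => // _; rewrite ler0n.
apply: (@etaq_div _ 1 0 0 0 1 0 0 0 2 0 0 0).
transitivity (fps_iprod u * (euler 1 * euler 6)).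
  by rewrite [in RHS]euler1_etaq euler6_etaq etaqM.
transitivity (euler 3 ^+ 2); last by rewrite euler3_etaq expr2 etaqM.
have -> : euler 1 = qpoch 3 1 * qpoch 3 2 * euler 3.
  rewrite (@euler_regroup 1 3) // !big_ord_recr big_ord0 /= mul1r.
  by rewrite (euler_qpoch 3).
have uM : fps_iprod u * (qpoch 3 1 * qpoch 3 2) = qpoch 6 3.
  rewrite /qpoch -fps_iprodM -?fps_iprodM //; try exact: qpoch_multipliable; last first.
    by apply: fps_multipliableM; apply: qpoch_multipliable.
  apply: eq_fps_iprod => i; rewrite /u.
  have -> : (6 * i + 3 = (3 * i + 1) + (3 * i + 2))%N by lia.
  have ga := @fps_geoM (3 * i + 1) ltac:(lia).
  have gb := @fps_geoM (3 * i + 2) ltac:(lia).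
  rewrite (fpsXD _ (3 * i + 1)%N); move: ga gb.
  move: (fpsX _ (3 * i + 1)) (fps_geo (3 * i + 1)).
  move: (fpsX _ (3 * i + 2)) (fps_geo (3 * i + 2)).
  move=> b gb a ga gaE gbE.
  transitivity (((1 - b) * gb) * (1 - a) + a * ((1 - a) * ga) * (1 - b)); first by ring.
  by rewrite gaE gbE; ring.
transitivity (fps_iprod u * (qpoch 3 1 * qpoch 3 2) * euler 6 * euler 3); first by ring.
by rewrite uM -(@euler_split2 3).
Qed.

Lemma dil3_etaq a b d :
  fps_dil 3 (etaq a b 0 d 0 0) = etaq 0 0 a 0 b d.
Proof.
have dilM (f g : fps int) := fps_dilM f g (ltn0Sn 2).
have dilX := morph_exprz (fps_dil1 _ (ltn0Sn 2)) dilM.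
rewrite !etaqE !dilM !dilX ?euler_unit // !dil_euler // !expr0z.
by rewrite !mulr1 !mul1r.
Qed.

(** f_3 / f_1 is f_3^2 / (f_1 f_6) times f_6 / f_3, and the latter is f_2 / f_1 at q^3. *)
Lemma f3_over_f1_pos : fps_pos (etaq (-1) 0 1 0 0 0).
Proof.
have := fps_posM f3_sqr_over_f1_f6_pos (fps_nneg_dil 3 (fps_posW f2_over_f1_pos)).
by rewrite dil3_etaq etaqM.
Qed.

Lemma f6_over_f3_nneg : fps_nneg (etaq 0 0 (-1) 0 1 0).
Proof. by rewrite -dil3_etaq; apply/fps_nneg_dil/fps_posW/f2_over_f1_pos. Qed.

Lemma f6_over_f2_nneg : fps_nneg (etaq 0 (-1) 0 0 1 0).
Proof. by rewrite -dil2_etaq; apply/fps_nneg_dil/fps_posW/f3_over_f1_pos. Qed.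

Lemma f12_over_f4_nneg : fps_nneg (etaq 0 0 0 (-1) 0 1).
Proof. by rewrite -dil2_etaq; apply/fps_nneg_dil/f6_over_f2_nneg. Qed.

Lemma inv_f2_nneg : fps_nneg (etaq 0 (-1) 0 0 0 0).
Proof. by rewrite -dil2_etaq; apply/fps_nneg_dil/inv_f1_nneg. Qed.

Lemma inv_f4_nneg : fps_nneg (etaq 0 0 0 (-1) 0 0).
Proof. by rewrite -dil2_etaq; apply/fps_nneg_dil/inv_f2_nneg. Qed.

Lemma inv_f3_nneg : fps_nneg (etaq 0 0 (-1) 0 0 0).
Proof. by rewrite -dil3_etaq; apply/fps_nneg_dil/inv_f1_nneg. Qed.

Lemma inv_f6_nneg : fps_nneg (etaq 0 0 0 0 (-1) 0).
Proof. by rewrite -dil3_etaq; apply/fps_nneg_dil/inv_f2_nneg. Qed.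

Lemma distinct_odd3_nneg : fps_nneg (etaq 0 0 (-1) 0 2 (-1)).
Proof. by rewrite -dil3_etaq; apply/fps_nneg_dil/distinct_odd_nneg. Qed.

Lemma fps_coefMn (R : comUnitRingType) (f : fps R) k n : (f *+ k) n = f n *+ k.
Proof. by elim: k => [|k IHk]; rewrite ?mulr0n // !mulrS fps_coefD IHk. Qed.

Lemma fps_dilMn (R : comUnitRingType) d (f : fps R) k :
  fps_dil d (f *+ k) = fps_dil d f *+ k.
Proof.
by apply: fpsP => n; rewrite fps_coefMn /= fps_coefMn; case: ifP; rewrite ?mul0rn.
Qed.

Lemma fps_negMn (R : comUnitRingType) (f : fps R) k :
  fps_neg (f *+ k) = fps_neg f *+ k.
Proof. by apply: fpsP => n; rewrite fps_coefMn /= fps_coefMn mulrnAr. Qed.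

Lemma fps_posMn f k : (0 < k)%N -> fps_pos f -> fps_pos (f *+ k).
Proof. by move=> k0 fP n; rewrite fps_coefMn pmulrn_lgt0. Qed.

(** * Two-dissections and signs *)

Lemma fps_coef_dissect2 (R : comUnitRingType) (f g : fps R) n :
  (fps_dil 2 f + fpsX R 1 * fps_dil 2 g) n = if odd n then g n./2 else f n./2.
Proof.
rewrite fps_coefD fps_coefXM; case: n => [|n] /=; first by rewrite addr0.
rewrite subn1 /= !dvdn2 /= negbK !divn2 /= !uphalf_half.
by case: (odd n); rewrite /= ?addr0 ?add0r.
Qed.

Lemma fps_pos_dissect2 f g : fps_pos f -> fps_pos g ->
  fps_pos (fps_dil 2 f + fpsX int 1 * fps_dil 2 g).
Proof. by move=> fP gP n; rewrite fps_coef_dissect2; case: ifP. Qed.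

(** Positivity of g(-q) means that g has sign (-1)^j at q^j; the exponents 4n + 1 and 4n + 3
    correspond to j = 2n and j = 2n + 1. *)
Lemma dissect2_sign_pattern f g n : fps_pos f -> fps_pos (fps_neg g) ->
  let h := fps_dil 2 f + fpsX int 1 * fps_dil 2 g in
  [/\ 0 < h (2 * n)%N, 0 < h (4 * n + 1)%N & h (4 * n + 3)%N < 0].
Proof.
move=> fP gP h; rewrite /h !fps_coef_dissect2.
have -> : odd (2 * n) = false by lia.
have -> : odd (4 * n + 1) by lia.
have -> : odd (4 * n + 3) by lia.
have -> : (4 * n + 1)./2 = (2 * n)%N by lia.
have -> : (4 * n + 3)./2 = (2 * n).+1 by lia.
have := gP (2 * n)%N; have := gP (2 * n).+1.
rewrite /= exprS exprM sqrrN !expr1n mulr1 mul1r mulN1r oppr_gt0.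
by split.
Qed.

Lemma etaq_dissection1 : etaq (-1) 1 3 (-3) 0 0 =
  fps_dil 2 (etaq (-1) 0 2 0 (-1) 0) + fpsX int 1 * fps_dil 2 (etaq 1 (-4) 0 0 3 0).
Proof.
transitivity ((1 + hauptmodul12) * etaq 0 (-1) 0 0 2 (-1)).
  by rewrite one_plus_v etaqM.
by rewrite mulrDl mul1r -mulrA etaqM !dil2_etaq.
Qed.

Lemma etaq_dissection2 : etaq (-3) 8 1 (-7) 0 0 =
  fps_dil 2 (etaq (-1) (-1) 3 0 (-2) 0) +
  fpsX int 1 * fps_dil 2 (etaq 1 (-5) 1 0 2 0 *+ 3).
Proof.
transitivity ((1 + 3 * hauptmodul12) * etaq 0 (-1) 0 (-1) 3 (-2)).
  by rewrite one_plus_3v etaqM.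
rewrite fps_dilMn -[fps_dil 2 _ *+ 3]mulr_natl.
rewrite mulrDl mul1r -2!mulrA etaqM !dil2_etaq; congr (_ + _).
by rewrite mulrCA.
Qed.

(** Under q -> -q the quotient becomes f_6^3 / (f_1 f_2 f_4) = (f_3 / f_1)(f_6 / f_2)(f_12 / f_4)
    f_6^2 / (f_3 f_12). *)
Lemma neg_odd_part1_pos : fps_pos (fps_neg (etaq 1 (-4) 0 0 3 0)).
Proof.
have := fps_posM (fps_posM (fps_posM f3_over_f1_pos f6_over_f2_nneg)
  f12_over_f4_nneg) distinct_odd3_nneg.
by rewrite !etaqM neg_etaq.
Qed.

(** Under q -> -q the quotient becomes f_6^5 / (f_1 f_2^2 f_3 f_4 f_12). *)
Lemma neg_odd_part2_pos : fps_pos (fps_neg (etaq 1 (-5) 1 0 2 0)).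
Proof.
have := fps_posM (fps_posM f3_over_f1_pos (fps_nnegM f6_over_f2_nneg f6_over_f2_nneg))
  (fps_nnegM (fps_nnegM f6_over_f3_nneg inv_f4_nneg) distinct_odd3_nneg).
by rewrite !etaqM neg_etaq.
Qed.

(** The second use of 1 + v: the halves are (f_2 / f_1)^3 / f_6 and (f_3 / f_1)(f_6 / f_2)(f_6 /
    f_3)^2 / f_3. *)
Lemma even_part2_pos : fps_pos (etaq (-1) (-1) 3 0 (-2) 0).
Proof.
have -> : etaq (-1) (-1) 3 0 (-2) 0 = fps_dil 2 (etaq (-3) 3 0 0 (-1) 0) +
    fpsX int 1 * fps_dil 2 (etaq (-1) (-1) (-2) 0 3 0).
  transitivity ((1 + hauptmodul12) * etaq 0 (-3) 0 3 0 (-1)).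
    by rewrite one_plus_v etaqM.
  by rewrite mulrDl mul1r -mulrA etaqM !dil2_etaq.
apply: fps_pos_dissect2.
  have := fps_posM f2_over_f1_pos (fps_nnegM (fps_posW f2_over_f1_pos)
    (fps_nnegM (fps_posW f2_over_f1_pos) inv_f6_nneg)).
  by rewrite !etaqM.
have := fps_posM (fps_posM f3_over_f1_pos f6_over_f2_nneg)
  (fps_nnegM (fps_nnegM f6_over_f3_nneg f6_over_f3_nneg) inv_f3_nneg).
by rewrite !etaqM.
Qed.

Lemma eta_coef_etaq (a b c d : int) n :
  eta_coef [tuple a; b; c; d] n = etaq a b c d 0 0 n.
Proof.
rewrite etaqE !expr0z !mulr1 /eta_coef; congr (fps_coef _ n).
rewrite !big_ord_recr big_ord0 /= mul1r.
by rewrite !(tnth_nth 0).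
Qed.

Theorem theorem4p1 (t : 4.-tuple int) (ht : t \in S4) (n : nat) :
  [/\ 0 < eta_coef t (2 * n)%N,
      0 < eta_coef t (4 * n + 1)%N &
      eta_coef t (4 * n + 3)%N < 0].
Proof.
move: ht; rewrite !inE => /orP[] /eqP ->; rewrite !eta_coef_etaq.
  rewrite etaq_dissection1; apply: dissect2_sign_pattern.
    exact: f3_sqr_over_f1_f6_pos.
  exact: neg_odd_part1_pos.
rewrite etaq_dissection2; apply: dissect2_sign_pattern; first exact: even_part2_pos.
by rewrite fps_negMn; apply: fps_posMn => //; apply: neg_odd_part2_pos.
Qed.
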